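(* There exist infinitely many distinct logics that extend fundamental logic and are contained both in orthologic and in the implication-free fragment of intuitionistic logic.
   Context: Formulas use variables, $\top,\bot,\wedge,\vee,\lnot$ (no implication). A fundamental lattice is a bounded lattice with unary $\lnot$ that is antitone, satisfies $a\wedge\lnot a=0$ and $a\le\lnot\lnot a$; an entailment $\varphi\vdash\psi$ is valid in $L$ if $v(\varphi)\le v(\psi)$ for all valuations. Fundamental logic is the set of entailments valid in all fundamental lattices; a logic extending fundamental logic is, for some set $\Gamma$ of entailments, the set of entailments valid in every fundamental lattice validating $\Gamma$. Orthologic is the set of entailments valid in all ortholattices (fundamental lattices with $\lnot\lnot a=a$); the implication-free fragment of intuitionistic logic is the set valid in all Heyting lattices (distributive fundamental lattices with $a\wedge b=0\Rightarrow b\le\lnot a$). *)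

(* Defs.v *)
From mathcomp Require Import all_boot all_order.
From mathcomp Require Import boolp classical_sets cardinality.

Set Implicit Arguments.
Unset Strict Implicit.
Unset Printing Implicit Defensive.

Inductive formula : Type :=
| Var of nat
| Top
| Bot
| And of formula & formula
| Or of formula & formula
| Neg of formula.

(* (phi, psi) stands for the entailment phi |- psi *)
Definition entailment : Type := (formula * formula)%type.

Local Open Scope order_scope.

(* The one-element lattice (\bot = \top) is allowed.  The choice structure and
   the boolean order that tbLatticeType imposes on the carrier are no
   restriction in the presence of the axioms of boolp. *)
Record fundLattice := FundLattice {
  fl_disp : Order.disp_t;
  fl_sort :> tbLatticeType fl_disp;
  neg : fl_sort -> fl_sort;
  neg_antitone : forall a b : fl_sort, a <= b -> neg b <= neg a;
  meet_neg : forall a : fl_sort, a `&` neg a = \bot;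
  le_negneg : forall a : fl_sort, a <= neg (neg a)
}.

Definition ortholattice (L : fundLattice) : Prop :=
  forall a : L, neg (neg a) = a.

Definition heyting_lattice (L : fundLattice) : Prop :=
  (forall a b c : L, a `&` (b `|` c) = (a `&` b) `|` (a `&` c)) /\
  (forall a b : L, a `&` b = \bot -> b <= neg a).

Fixpoint eval (L : fundLattice) (v : nat -> L) (phi : formula) : L :=
  match phi with
  | Var n => v n
  | Top => \top
  | Bot => \bot
  | And phi psi => eval v phi `&` eval v psi
  | Or phi psi => eval v phi `|` eval v psi
  | Neg phi => neg (eval v phi)
  end.

Definition valid_in (L : fundLattice) (e : entailment) : Prop :=
  forall v : nat -> L, eval v e.1 <= eval v e.2.

Local Close Scope order_scope.
Local Open Scope classical_set_scope.

Definition validates (L : fundLattice) (Gamma : set entailment) : Prop :=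
  forall e, Gamma e -> valid_in L e.

Definition logic_of (C : fundLattice -> Prop) : set entailment :=
  [set e | forall L : fundLattice, C L -> valid_in L e].

Definition orthologic : set entailment := logic_of ortholattice.

Definition intuitionistic_fragment : set entailment :=
  logic_of heyting_lattice.

Definition extends_fundamental_logic (K : set entailment) : Prop :=
  exists Gamma : set entailment, K = logic_of (validates^~ Gamma).

(* Main.v *)
(* For lattice terms [s], [t] with [s <= t] in every distributive lattice, the
   entailment [~~p /\ s |- p \/ t] holds in ortholattices, where [~~p = p], and
   in Heyting lattices.  Take for [s] the meet of the joins of all pairs among
   [n >= 3] variables, and for [t] the join of their meets: [s <= t] also holds,
   by the pigeonhole principle, in every lattice with fewer than [n] elements.
   In the lattice [M_n] (bottom, top, [n] pairwise incomparable atoms) with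
   [~0 = 1] and [~x = 0] otherwise, distinct atoms give [s = 1] and [t = 0],
   while an atom [p] has [~~p = 1], so the entailment fails.  As [M_n] has only
   [n + 2] elements, it separates the entailment with [n] variables from those
   with at least [n + 3] variables. *)
From HB Require Import structures.
Require Import Defs.
From mathcomp Require Import all_boot all_order.
From mathcomp Require Import boolp classical_sets cardinality.

Import Order.TTheory.

Local Open Scope order_scope.

(** * The lattice [M_n] as a fundamental lattice *)

Section Diamond.

Variable n : nat.

(* [None] is the bottom, [Some None] the top, and the [Some (Some i)] are the
   atoms. *)
Definition diamond : Type := option (option 'I_n).

HB.instance Definition _ := Finite.on diamond.

Definition diamond_le (a b : diamond) : bool :=
  [|| a == None, b == Some None | a == b].

Definition diamond_meet (a b : diamond) : diamond :=
  if diamond_le a b then a else if diamond_le b a then b else None.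

Definition diamond_join (a b : diamond) : diamond :=
  if diamond_le a b then b else if diamond_le b a then a else Some None.

Lemma diamond_le_refl : reflexive diamond_le.
Proof. by move=> a; rewrite /diamond_le eqxx !orbT. Qed.

Lemma diamond_le_anti : antisymmetric diamond_le.
Proof.
move=> [[i|]|] [[j|]|]; rewrite /diamond_le //=.
by case/andP=> /eqP.
Qed.

Lemma diamond_le_trans : transitive diamond_le.
Proof.
move=> [[i|]|] [[j|]|] [[k|]|]; rewrite /diamond_le //=.
by move=> /eqP[->].
Qed.

HB.instance Definition _ := Order.Le_isPOrder.Build (Order.Disp tt tt)
  diamond diamond_le_refl diamond_le_anti diamond_le_trans.

Lemma diamond_meetP (a b c : diamond) :
  diamond_le a (diamond_meet b c) = diamond_le a b && diamond_le a c.
Proof.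
rewrite /diamond_meet; case: ifP => [bc|Nbc].
  by case: (boolP (diamond_le a b)) => //= ab; rewrite (diamond_le_trans _ _ _ ab bc).
case: ifP => [cb|Ncb].
  by rewrite andbC; case: (boolP (diamond_le a c)) => //= ac; rewrite (diamond_le_trans _ _ _ ac cb).
(* Only the case of three atoms survives: an atom below two atoms equals both, so these would be
   comparable. *)
move: a b c Nbc Ncb => [[i|]|] [[j|]|] [[k|]|] // Njk _.
apply/esym/negbTE/negP; rewrite /diamond_le /=.
by case/andP=> /eqP[ij] /eqP[ik]; rewrite -ij -ik diamond_le_refl in Njk.
Qed.

Lemma diamond_joinP (a b c : diamond) :
  diamond_le (diamond_join a b) c = diamond_le a c && diamond_le b c.
Proof.
rewrite /diamond_join; case: ifP => [ab|Nab].
  by rewrite andbC; case: (boolP (diamond_le b c)) => //= bc; rewrite (diamond_le_trans _ _ _ ab bc).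
case: ifP => [ba|Nba].
  by case: (boolP (diamond_le a c)) => //= ac; rewrite (diamond_le_trans _ _ _ ba ac).
move: a b c Nab Nba => [[i|]|] [[j|]|] [[k|]|] // Nij _.
apply/esym/negbTE/negP; rewrite /diamond_le /=.
by case/andP=> /eqP[ij] /eqP[ik]; rewrite ij ik diamond_le_refl in Nij.
Qed.

HB.instance Definition _ := Order.POrder_MeetJoin_isLattice.Build
  (Order.Disp tt tt) diamond diamond_meetP diamond_joinP.

Lemma diamond_le0x (a : diamond) : (None : diamond) <= a.
Proof. by []. Qed.

Lemma diamond_lex1 (a : diamond) : a <= (Some None : diamond).
Proof. by case: a => [[]|]. Qed.

HB.instance Definition _ := Order.hasBottom.Build (Order.Disp tt tt)
  diamond diamond_le0x.
HB.instance Definition _ := Order.hasTop.Build (Order.Disp tt tt)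
  diamond diamond_lex1.

Definition diamond_neg (a : diamond) : diamond :=
  if a is None then \top else \bot.

Lemma diamond_neg_antitone (a b : diamond) :
  a <= b -> diamond_neg b <= diamond_neg a.
Proof. by case: a b => [[i|]|] [[j|]|]. Qed.

Lemma diamond_meet_neg (a : diamond) : a `&` diamond_neg a = \bot.
Proof. by case: a => [a|] /=; rewrite ?meetx0 ?meet0x. Qed.

Lemma diamond_le_negneg (a : diamond) : a <= diamond_neg (diamond_neg a).
Proof. by case: a => [[i|]|]. Qed.

Definition diamond_fundLattice : fundLattice :=
  FundLattice diamond_neg_antitone diamond_meet_neg diamond_le_negneg.

Definition atom (i : 'I_n) : diamond := Some (Some i).

Lemma diamond_le_atom (i j : 'I_n) : diamond_le (atom i) (atom j) = (i == j).
Proof. by apply/eqP/eqP => [[]|->]. Qed.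

Lemma join_atom (i j : 'I_n) : i != j -> atom i `|` atom j = \top.
Proof.
move=> Nij; rewrite /Order.join /= /diamond_join !diamond_le_atom.
by rewrite [j == i]eq_sym (negbTE Nij).
Qed.

Lemma meet_atom (i j : 'I_n) : i != j -> atom i `&` atom j = \bot.
Proof.
move=> Nij; rewrite /Order.meet /= /diamond_meet !diamond_le_atom.
by rewrite [j == i]eq_sym (negbTE Nij).
Qed.

Lemma card_diamond : #|{: diamond}| = n.+2.
Proof. by rewrite !card_option card_ord. Qed.

End Diamond.

(** * When the meet of pairwise joins lies below the join of pairwise meets *)

Section PairwiseTerms.

Context {disp : Order.disp_t} {L : tbLatticeType disp} {n : nat}.
Implicit Type x : 'I_n -> L.

Definition meet_of_joins x : L :=
  \meet_(p : 'I_n * 'I_n | (p.1 < p.2)%N) (x p.1 `|` x p.2).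

Definition join_of_meets x : L :=
  \join_(p : 'I_n * 'I_n | (p.1 < p.2)%N) (x p.1 `&` x p.2).

Lemma meet_of_joins_le x (i j : 'I_n) :
  (i < j)%N -> meet_of_joins x <= x i `|` x j.
Proof.
by move=> ij; apply: (@meets_inf _ _ _ (i, j) _ (fun p => x p.1 `|` x p.2)).
Qed.

Lemma join_of_meets_ge x (i j : 'I_n) :
  (i < j)%N -> x i `&` x j <= join_of_meets x.
Proof.
by move=> ij; apply: (@joins_sup _ _ _ (i, j) _ (fun p => x p.1 `&` x p.2)).
Qed.

(** Three of the elements suffice: [m] splits along [x i0] and [x i1], and meeting each half with a
    pair join that avoids its element leaves only meets of two distinct indices. *)
Lemma pairwise_le_distributive x :
  (forall a b c : L, a `&` (b `|` c) = (a `&` b) `|` (a `&` c)) ->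
  (2 < n)%N -> meet_of_joins x <= join_of_meets x.
Proof.
move=> meetUr n_gt2.
pose i0 := Ordinal (ltnW (ltnW n_gt2)); pose i1 := Ordinal (ltnW n_gt2).
pose i2 := Ordinal n_gt2.
set m := meet_of_joins x.
have le01 : m <= x i0 `|` x i1 by exact: meet_of_joins_le.
have le02 : m <= x i0 `|` x i2 by exact: meet_of_joins_le.
have le12 : m <= x i1 `|` x i2 by exact: meet_of_joins_le.
have -> : m = (m `&` x i0) `|` (m `&` x i1) by rewrite -meetUr; apply/esym/meet_idPl.
rewrite leUx; apply/andP; split.
  apply: (le_trans (leI2 le12 (lexx _))); rewrite meetC meetUr leUx.
  by rewrite !join_of_meets_ge.
apply: (le_trans (leI2 le02 (lexx _))); rewrite meetC meetUr leUx.
by rewrite [x i1 `&` _]meetC !join_of_meets_ge.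
Qed.

(** A repeated value [x i = x j] is both the join and the meet of that pair, hence lies between the
    two terms. *)
Lemma pairwise_le_not_injective x :
  ~ injective x -> meet_of_joins x <= join_of_meets x.
Proof.
move=> Ninj.
have [i [j [ij xij]]] : exists i j : 'I_n, (i < j)%N /\ x i = x j.
  apply: contrapT => Nex; apply: Ninj => i j xij; apply: val_inj => /=.
  case: (ltngtP i j) => // [ij|ji]; exfalso; apply: Nex.
    by exists i, j.
  by exists j, i.
have := meet_of_joins_le x i j ij; have := join_of_meets_ge x i j ij.
by rewrite xij joinxx meetxx => /[swap]; apply: le_trans.
Qed.

End PairwiseTerms.

(** * The separating entailments *)

Definition pair_entailment (n : nat) : entailment :=
  (And (Neg (Neg (Var 0)))
    (\big[And/Top]_(p : 'I_n * 'I_n | (p.1 < p.2)%N)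
       Or (Var p.1.+1) (Var p.2.+1)),
   Or (Var 0)
    (\big[Or/Bot]_(p : 'I_n * 'I_n | (p.1 < p.2)%N)
       And (Var p.1.+1) (Var p.2.+1))).

Lemma pair_entailmentE (L : fundLattice) (n : nat) :
  valid_in L (pair_entailment n) <->
  forall (p : L) (x : 'I_n -> L),
    neg (neg p) `&` meet_of_joins x <= p `|` join_of_meets x.
Proof.
have ev (v : nat -> L) :
    eval v (pair_entailment n).1 =
      neg (neg (v 0%N)) `&` meet_of_joins (fun i : 'I_n => v i.+1) /\
    eval v (pair_entailment n).2 =
      v 0%N `|` join_of_meets (fun i : 'I_n => v i.+1).
  split => /=.
    by rewrite (@big_morph _ _ (eval v) \top Order.meet Top And (fun _ _ => erefl) erefl).
  by rewrite (@big_morph _ _ (eval v) \bot Order.join Bot Or (fun _ _ => erefl) erefl).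
split=> [val p x|le_px v]; last first.
  by have [-> ->] := ev v; exact: le_px (v 0%N) (fun i => v i.+1).
(* Variable 0 carries [p] and variable [i.+1] carries [x i]; the default [\bot] is only met at
   variables that do not occur in the entailment. *)
pose v k := if k is k'.+1 then oapp x \bot (insub k') else p.
have := val v; have [-> ->] := ev v.
suff -> : (fun i : 'I_n => v i.+1) = x by [].
by apply: funext => i; rewrite /= valK.
Qed.

Lemma pair_entailment_ortholattice (n : nat) : orthologic (pair_entailment n).
Proof.
by move=> L ortho; apply/pair_entailmentE => p x; rewrite ortho leIxl // leUl.
Qed.

Lemma pair_entailment_heyting (n : nat) :
  (2 < n)%N -> intuitionistic_fragment (pair_entailment n).
Proof.
move=> n_gt2 L [meetUr _]; apply/pair_entailmentE => p x.
by rewrite leIxr // lexUr // pairwise_le_distributive.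
Qed.

Lemma pair_entailment_diamond (m n : nat) :
  (m.+2 < n)%N -> valid_in (diamond_fundLattice m) (pair_entailment n).
Proof.
move=> mn; apply/pair_entailmentE => p x.
rewrite leIxr // lexUr // pairwise_le_not_injective // => /leq_card.
by rewrite card_diamond card_ord leqNgt mn.
Qed.

Lemma pair_entailment_diamondN (n : nat) :
  (0 < n)%N -> ~ valid_in (diamond_fundLattice n) (pair_entailment n).
Proof.
(* Any atom serves as [p]: the instance reduces to [\top] being below an atom. *)
move=> n_gt0 /pair_entailmentE/(_ (atom n (Ordinal n_gt0)) (atom n)).
rewrite /meet_of_joins big1 => [|p ltp]; last by rewrite join_atom // neq_ltn ltp.
rewrite /join_of_meets big1 => [|p ltp]; last by rewrite meet_atom // neq_ltn ltp.
by rewrite meetx1 joinx0.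
Qed.

Local Open Scope classical_set_scope.

(** Sizes start at 3, as the distributive case demands, and grow by 3, so that [M_n], with [n + 2]
    elements, is too small to refute the next entailment. *)
Definition tail_entailments (k : nat) : set entailment :=
  [set e | exists2 m, (k <= m)%N & e = pair_entailment (3 * m.+1)].

Definition tail_logic (k : nat) : set entailment :=
  logic_of (validates^~ (tail_entailments k)).

Lemma tail_logic_sub (C : fundLattice -> Prop) (k : nat) :
  (forall m, logic_of C (pair_entailment (3 * m.+1))) ->
  tail_logic k `<=` logic_of C.
Proof. by move=> Ce e Ke L CL; apply: Ke => _ [m _ ->]; apply: Ce. Qed.

Lemma tail_logic_pair_entailment (k m : nat) :
  tail_logic k (pair_entailment (3 * m.+1)) <-> (k <= m)%N.
Proof.
split=> [Kkm|km L]; last by apply; exists m.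
rewrite leqNgt; apply/negP => mk.
(* For [m < k], the diamond with [3 * m.+1] atoms validates the whole tail from [k] but refutes
   entailment [m]. *)
apply: (pair_entailment_diamondN (3 * m.+1)) => //.
apply: Kkm => _ [m' km' ->]; apply: pair_entailment_diamond.
have : (m.+2 <= m'.+1)%N by exact: leq_ltn_trans mk _.
by rewrite -(leq_pmul2l (isT : 0 < 3)%N); apply: leq_trans; rewrite [X in (_ <= X)%N]mulnS.
Qed.

(** The index [k] is recovered as the least [m] whose entailment belongs to the logic. *)
Lemma tail_logic_inj : injective tail_logic.
Proof.
move=> k l kl; apply/eqP; rewrite eqn_leq; apply/andP; split.
  by apply/tail_logic_pair_entailment; rewrite kl; apply/tail_logic_pair_entailment.
by apply/tail_logic_pair_entailment; rewrite -kl; apply/tail_logic_pair_entailment.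
Qed.

Theorem theorem7p1 :
  infinite_set [set K : set entailment |
    [/\ extends_fundamental_logic K,
        K `<=` orthologic
      & K `<=` intuitionistic_fragment]].
Proof.
move=> fin; apply: infinite_nat.
(* Finitely many such logics would have a finite preimage under the injective [tail_logic], yet this
   preimage is all of [nat]. *)
have : finite_set (tail_logic @^-1` _) := finite_preimage (in2W tail_logic_inj) fin.
apply: sub_finite_set => k _; split.
- by exists (tail_entailments k).
- by apply: tail_logic_sub => m; apply: pair_entailment_ortholattice.
- apply: tail_logic_sub => m; apply: pair_entailment_heyting.
  by rewrite mulnS leq_addr.
Qed.
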